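(* Let $\lambda>-1$ and $t\in\mathbb{R}$. For the generalised decic Freud weight $\omega(x;t)=|x|^{2\lambda+1}\exp(-x^{10}+tx^2)$, $x\in\mathbb{R}$, the first moment is given by \begin{align*} \mu_0(t;\lambda)&=\int_{-\infty}^{\infty}|x|^{2\lambda+1}\exp(-x^{10}+tx^2)\,dx=\int_0^\infty s^\lambda\exp(-s^5+ts)\,ds\\ &=\tfrac15\Gamma(\tfrac15\lambda+\tfrac15)\;{}_1F_4\left(\tfrac15\lambda+\tfrac15;\tfrac15,\tfrac25,\tfrac35,\tfrac45;(\tfrac15t)^5\right)+\tfrac15\,t\,\Gamma(\tfrac15\lambda+\tfrac25)\;{}_1F_4\left(\tfrac15\lambda+\tfrac25;\tfrac25,\tfrac35,\tfrac45,\tfrac65;(\tfrac15t)^5\right)\\ &\quad+\tfrac1{10}\,t^2\,\Gamma(\tfrac15\lambda+\tfrac35)\;{}_1F_4\left(\tfrac15\lambda+\tfrac35;\tfrac35,\tfrac45,\tfrac65,\tfrac75;(\tfrac15t)^5\right)+\tfrac1{30}\,t^3\,\Gamma(\tfrac15\lambda+\tfrac45)\;{}_1F_4\left(\tfrac15\lambda+\tfrac45;\tfrac45,\tfrac65,\tfrac75,\tfrac85;(\tfrac15t)^5\right)\\ &\quad+\tfrac1{120}\,t^4\,\Gamma(\tfrac15\lambda+1)\;{}_1F_4\left(\tfrac15\lambda+1;\tfrac65,\tfrac75,\tfrac85,\tfrac95;(\tfrac15t)^5\right). \end{align*} Further, $\varphi=\mu_0(t;\lambda)$ satisfies the fifth-order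 equation $$\frac{d^5\varphi}{dt^5}-\tfrac15t\frac{d\varphi}{dt}-\tfrac15(\lambda+1)\varphi=0,$$ and the first recurrence coefficient $\beta_1(t;\lambda)=\frac{d}{dt}\ln\mu_0(t;\lambda)$ satisfies the fourth-order equation $$\frac{d^4\beta_1}{dt^4}+5\beta_1\frac{d^3\beta_1}{dt^3}+10\left(\frac{d\beta_1}{dt}+\beta_1^2\right)\frac{d^2\beta_1}{dt^2}+15\beta_1\left(\frac{d\beta_1}{dt}\right)^2+10\beta_1^3\frac{d\beta_1}{dt}+\beta_1^5-\tfrac15t\beta_1=\tfrac15(\lambda+1).$$
   Context: ${}_1F_4(a_1;b_1,b_2,b_3,b_4;z)=\sum_{k=0}^\infty\frac{(a_1)_k}{(b_1)_k(b_2)_k(b_3)_k(b_4)_k}\frac{z^k}{k!}$ is the generalised hypergeometric function, where $(a)_k=a(a+1)\cdots(a+k-1)$, $(a)_0=1$. $\beta_1$ is the coefficient in $P_{2}(x)=xP_1(x)-\beta_1P_0(x)$ for the monic polynomials orthogonal with respect to the weight. *)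

(* Defs.v *)
From HB Require Import structures.
From mathcomp Require Import all_boot all_order all_algebra.
From mathcomp Require Import all_classical all_reals all_analysis.

Set Implicit Arguments.
Unset Strict Implicit.
Unset Printing Implicit Defensive.

Import Order.TTheory GRing.Theory Num.Theory.
Import numFieldNormedType.Exports.

Local Open Scope classical_set_scope.
Local Open Scope ring_scope.

(* Euler's integral; only meaningful for 0 < x, where it converges. *)
Definition Gamma (R : realType) (x : R) : R :=
  \int[lebesgue_measure]_(s in `]0, +oo[) (s `^ (x - 1) * expR (- s)).

Definition pochhammer (R : realType) (a : R) (k : nat) : R :=
  \prod_(i < k) (a + i%:R).

(* The limit of the partial sums; the series converges for every z as soon as
   none of b1, ..., b4 is a nonpositive integer. *)
Definition hyp1F4 (R : realType) (a b1 b2 b3 b4 z : R) : R :=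
  limn (series (fun k : nat =>
    pochhammer a k
       / (pochhammer b1 k * pochhammer b2 k * pochhammer b3 k * pochhammer b4 k)
     * (z ^+ k / k`!%:R))).

Definition decic_weight (R : realType) (lambda t x : R) : R :=
  `|x| `^ (2 * lambda + 1) * expR (- x ^+ 10 + t * x ^+ 2).

Definition mu0 (R : realType) (lambda t : R) : R :=
  \int[lebesgue_measure]_x decic_weight lambda t x.

(* The orthogonality integral is taken in the extended reals: it is 0 only when
   the integrand is integrable, whereas the real-valued integral would also be
   0 by default when the integral is infinite. *)
Definition monic_orthogonal (R : realType) (w : R -> R)
    (P : nat -> {poly R}) : Prop :=
  (forall n, P n \is monic /\ size (P n) = n.+1) /\
  (forall m n, m <> n ->
     (\int[lebesgue_measure]_x ((P m).[x] * (P n).[x] * w x)%:E = 0)%E).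

(* For an even weight the three-term recurrence has no term in P_n; it reads
   P_(n+1) = x P_n - beta_n P_(n-1) for 1 <= n. *)
Definition recurrence_coeff (R : realType) (w : R -> R) (n : nat) : R :=
  xget 0 [set b : R | exists2 P : nat -> {poly R},
    monic_orthogonal w P & P n.+1 = 'X * P n - b *: P n.-1].

Definition beta1 (R : realType) (lambda t : R) : R :=
  recurrence_coeff (decic_weight lambda t) 1.

(* Main.v *)
(** Expanding [expR (t * s)] and integrating term by term gives
    [mu0 lambda t = \sum_n c_n t^n] with
    [c_n = Gamma ((lambda + n + 1) / 5) / (5 * n!)] (after the substitutions
    [s = x^2] and [u = s^5]).  Everything except the formula for [beta1] is read
    off this entire series: [Gamma (x + 1) = x Gamma x] makes each residue class
    of [n] modulo 5 a 1F4 series, termwise differentiation shifts [lambda] to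
    [lambda + 1], and the recursion for [c_n] is the fifth-order equation.
    Positive definiteness of the moment functional makes its Hankel matrices
    invertible, so the orthogonal polynomials exist, and by parity
    [beta1 = mu0 (lambda + 1) / mu0 lambda] is the logarithmic derivative.  The
    fourth-order equation is then the fifth-order one written in terms of
    cumulants. *)

Require Import Defs.
From HB Require Import structures.
From mathcomp Require Import all_boot all_order all_algebra.
From mathcomp Require Import all_classical all_reals all_analysis.
From mathcomp Require Import measurable_realfun ring lra.

Import Order.TTheory GRing.Theory Num.Theory.
Import numFieldNormedType.Exports.

Local Open Scope classical_set_scope.
Local Open Scope ring_scope.

(** * Integrals over the positive half-line *)

Section exhaustion.
Context {R : realType}.
Let mu := @lebesgue_measure R.

(** The power [k] is built in so that x |-> x^k maps [expn_itv 1 n] onto [expn_itv k n]: one index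
    exhausts both sides of a substitution. *)
Definition expn_itv (k n : nat) : set R :=
  `[(n.+1%:R ^+ k)^-1, n.+1%:R ^+ k]%classic.

Lemma bigcup_expn_itv k : (0 < k)%N ->
  \bigcup_n expn_itv k n = `]0, +oo[%classic.
Proof.
move=> k0; apply/seteqP; split => [x [n _]|x]; rewrite /expn_itv/= !in_itv/=.
  by move=> /andP[+ _]; rewrite andbT; apply: lt_le_trans;
    rewrite invr_gt0 exprn_gt0.
rewrite andbT => x0.
have [m xm] : exists m : nat, Num.max x x^-1 <= m.+1%:R.
  exists (Num.bound (Num.max x x^-1)).
  have /ltW/le_trans : Num.max x x^-1 < (Num.bound (Num.max x x^-1))%:R.
    by rewrite archi_boundP// le_max (ltW x0).
  by apply; rewrite ler_nat.
exists m => //=; rewrite in_itv/=.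
have mk : m.+1%:R <= m.+1%:R ^+ k :> R by rewrite ler_eXnr// ler1n.
move: xm; rewrite ge_max => /andP[xm xVm].
rewrite (le_trans xm)// andbT -[leRHS]invrK lef_pV2 ?posrE ?invr_gt0//
  ?exprn_gt0//.
exact: le_trans mk.
Qed.

Lemma nondecreasing_expn_itv k : nondecreasing_seq (expn_itv k).
Proof.
move=> m n mn; apply/subsetPset => x; rewrite /expn_itv/= !in_itv/=.
have mnk : m.+1%:R ^+ k <= n.+1%:R ^+ k :> R.
  by rewrite lerXn2r ?nnegrE// ler_nat ltnS.
move=> /andP[mx xm]; rewrite (le_trans xm)// andbT (le_trans _ mx)//.
by rewrite lef_pV2 ?posrE// exprn_gt0.
Qed.

Lemma expn_itv_sub k n : (0 < k)%N -> expn_itv k n `<=` `]0, +oo[%classic.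
Proof. by move=> k0; rewrite -(bigcup_expn_itv k)//; exact: bigcup_sup. Qed.

Lemma cvg_integral_expn_itv k (f : R -> \bar R) : (0 < k)%N ->
  measurable_fun `](0:R), +oo[ f -> (forall x : R, 0 < x -> (0 <= f x)%E) ->
  ((\int[mu]_(x in expn_itv k n) f x) @[n --> \oo]
     --> \int[mu]_(x in `]0%R, +oo[) f x)%E.
Proof.
move=> k0 mf f0; rewrite -(bigcup_expn_itv k)//.
apply: ge0_nondecreasing_set_cvg_integral.
- exact: nondecreasing_expn_itv.
- by move=> i; exact: measurable_itv.
- by move=> i; apply: measurable_funS mf => //; exact: expn_itv_sub.
- move=> i x /(expn_itv_sub k i k0); rewrite /= in_itv/= andbT; exact: f0.
Qed.

Lemma pos_continuous_measurable (f : R -> R) :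
  (forall x : R, 0 < x -> {for x, continuous f}) ->
  measurable_fun `](0:R), +oo[ f.
Proof.
move=> cf; apply: open_continuous_measurable_fun; first exact: interval_open.
by move=> x; rewrite inE/= in_itv/= andbT; exact: cf.
Qed.

(** The substitution y = x^(k+1) is made on the compact intervals of the exhaustion; both integrands
    being nonnegative, monotone convergence carries it to the half-line, infinite values
    included. *)
Lemma integration_by_substitution_expn k (G : R -> R) :
  (forall x : R, 0 < x -> {for x, continuous G}) -> (forall x : R,
    0 < x -> 0 <= G x) ->
  (\int[mu]_(x in `]0%R, +oo[) (G x)%:E =
   \int[mu]_(x in `]0%R, +oo[) (G (x ^+ k.+1) * (k.+1%:R * x ^+ k))%:E)%E.
Proof.
move=> cG G0.
pose H (x : R) : R := G (x ^+ k.+1) * (k.+1%:R * x ^+ k).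
have cH (x : R) : 0 < x -> {for x, continuous H}.
  move=> x0; apply: continuousM; last first.
    by apply: continuousM; [exact: cst_continuous|exact: exprn_continuous].
  apply: (@continuous_comp _ _ _ (fun y : R => y ^+ k.+1) G).
    exact: exprn_continuous.
  by apply: cG; rewrite exprn_gt0.
have mG := pos_continuous_measurable _ cG.
have mH := pos_continuous_measurable _ cH.
have l1 := @cvg_integral_expn_itv k.+1 (EFin \o G) isT.
have l2 := @cvg_integral_expn_itv 1  (EFin \o H) isT.
have {}l1 := l1 (measurableT_comp (@EFin_measurable _ _) mG) G0.
have {}l2 := l2 (measurableT_comp (@EFin_measurable _ _) mH).
have {}l2 : (\int[mu]_(x in expn_itv 1 n) (EFin \o H) x)%E @[n --> \oo] -->
    (\int[mu]_(x in `]0%R, +oo[) (EFin \o H) x)%E.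
  apply: l2 => x x0; rewrite lee_fin /H mulr_ge0 ?G0 ?exprn_gt0//.
  by rewrite mulr_ge0// exprn_ge0// ltW.
suff E : (fun n => \int[mu]_(x in expn_itv k.+1 n) (EFin \o G) x)%E =
         (fun n => \int[mu]_(x in expn_itv 1 n) (EFin \o H) x)%E.
  by rewrite E in l1; exact: (cvg_unique _ l1 l2).
apply/funext => n.
  have e0 : 0 < (n.+1%:R ^+ 1)^-1 :> R by rewrite invr_gt0 exprn_gt0.
  have dX (x : R) : derive1 (fun x : R => x ^+ k.+1) x = k.+1%:R * x ^+ k.
    by rewrite exp_derive1 -mulr_natl.
  have lee : (n.+1%:R ^+ 1)^-1 <= n.+1%:R ^+ 1 :> R.
    by rewrite expr1 (@le_trans _ _ 1)// ?invf_le1 ?ler1n.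
  have cX (x : R) : (fun y : R => y ^+ k.+1) y @[y --> x] --> x ^+ k.+1.
    exact: exprn_continuous.
  have cdX (x : R) : {for x, continuous (fun y : R => k.+1%:R * y ^+ k)}.
    by apply: continuousM; [exact: cst_continuous|exact: exprn_continuous].
  have dXE : derive1 (fun x : R => x ^+ k.+1) = (fun x : R => k.+1%:R * x ^+ k).
    exact/funext.
  (* The endpoints are displayed as images of those of [expn_itv 1 n], the shape expected by the
     compact substitution rule. *)
  rewrite (_ : expn_itv k.+1 n =
      `[((n.+1%:R ^+ 1)^-1) ^+ k.+1, (n.+1%:R ^+ 1) ^+ k.+1]%classic);
        last first.
    by rewrite /expn_itv expr1 exprVn.
  rewrite (@integration_by_substitution_increasing R (fun x => x ^+ k.+1) G)//.
  - by apply: eq_integral => x _ /=; rewrite dXE.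
  - move=> x y; rewrite !in_itv/= => /andP[ex _] /andP[ey _] xy.
    by rewrite ltrXn2r//; apply: ltW; apply: lt_le_trans e0 _.
  - by rewrite dXE => x _; exact: cdX.
  - by rewrite dXE; apply/cvg_ex; eexists; apply: cvg_at_right_filter;
      exact: cdX.
  - by rewrite dXE; apply/cvg_ex; eexists; apply: cvg_at_left_filter;
      exact: cdX.
  - split.
    + by move=> x _; exact: exprn_derivable.
    + by apply: cvg_at_right_filter; exact: cX.
    + by apply: cvg_at_left_filter; exact: cX.
  - apply: continuous_in_subspaceT => x; rewrite inE/= in_itv/= => /andP[ex _].
    by apply: cG; rewrite (lt_le_trans _ ex)// exprn_gt0.
Qed.

End exhaustion.

(** * The Gamma integral *)

Section gamma.
Context {R : realType}.
Let mu := @lebesgue_measure R.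

Lemma continuous_powR_pos (p x : R) : 0 < x -> {for x,
  continuous (fun s : R => s `^ p)}.
Proof.
move=> x0; apply: differentiable_continuous; apply/derivable1_diffP.
by apply: ex_derive; exact: is_derive1_powR.
Qed.

Lemma continuous_expRN (x : R) : {for x, continuous (fun s : R => expR (- s))}.
Proof.
by apply: continuous_comp; [exact: continuousN|exact: continuous_expR].
Qed.

Lemma continuous_gamma_integrand (p x : R) : 0 < x ->
  {for x, continuous (fun s : R => s `^ p * expR (- s))}.
Proof.
by move=> x0; apply: continuousM;
  [exact: continuous_powR_pos|exact: continuous_expRN].
Qed.

(** This limit and the next one are the boundary terms of the integration by parts in [egammaS]; the
    exponent 1 matches the endpoints of [expn_itv 1 n]. *)
Lemma cvg_gamma_integrand0 (x : R) : 0 < x ->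
  ((n.+1%:R ^+ 1)^-1 `^ x * expR (- (n.+1%:R ^+ 1)^-1)) @[n --> \oo] --> (0 :
    R).
Proof.
move=> x0.
rewrite -[X in _ --> X](mul0r (expR (- 0))).
have h0 : (n.+1%:R ^+ 1)^-1 @[n --> \oo] --> (0 : R).
  by under eq_fun do rewrite expr1; exact: cvg_harmonic.
apply: cvgM.
  have h : (n.+1%:R ^+ 1)^-1 @[n --> \oo] --> (0 : R)^'+.
    move=> P /h0 [N _ NP]; exists N => // n Nn.
    by apply: (NP n Nn); rewrite invr_gt0 exprn_gt0.
  exact: (cvg_comp _ _ h (powR_cvg0 x0)).
apply: (cvg_comp _ _ h0 (continuous_expRN 0)).
Qed.

Lemma cvg_gamma_integrandy (x : R) : 0 <= x ->
  ((n.+1%:R ^+ 1) `^ x * expR (- (n.+1%:R ^+ 1))) @[n --> \oo] --> (0 : R).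
Proof.
move=> x0; under eq_fun do rewrite expr1.
pose m := Num.bound x.
have xm : x <= m%:R by apply/ltW; rewrite archi_boundP.
apply: (@squeeze_cvgr _ _ _ _ (cst 0) (fun n => (m.+1`!)%:R * (n.+1%:R)^-1)).
- apply: nearW => n; rewrite mulr_ge0 ?powR_ge0 ?expR_ge0//=.
  rewrite expRN ler_pdivrMr ?expR_gt0//.
  (* With y = n + 1, the bounds y^(m+1) / (m+1)! <= e^y and x <= m give y^x e^(-y) <= (m+1)! / y. *)
  have := @expR_ge1Dxn R n.+1%:R m (ler0n _ _) => h.
  have n0 : (0 : R) < n.+1%:R by rewrite ltr0n.
  have f0 : (0 : R) < m.+1`!%:R by rewrite ltr0n fact_gt0.
  apply: (@le_trans _ _ (n.+1%:R ^+ m)).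
    by rewrite -powR_mulrn//; apply: ler_powR => //; rewrite ler1n.
  rewrite mulrAC ler_pdivlMr// -exprSr mulrC -ler_pdivrMr//.
  by apply: le_trans h; rewrite lerDr.
- exact: cvg_cst.
- rewrite -(mulr0 (m.+1`!%:R : R)); apply: cvgM; first exact: cvg_cst.
  exact: cvg_harmonic.
Qed.

(** Extended-real values allow the functional equation to be proved first and finiteness to be
    deduced from it. *)
Definition egamma (x : R) : \bar R :=
  (\int[mu]_(s in `]0%R, +oo[) (s `^ (x - 1) * expR (- s))%:E)%E.

Lemma measurable_gamma_integrand (p : R) :
  measurable_fun `](0:R), +oo[ (fun s : R => s `^ p * expR (- s)).
Proof.
by apply: pos_continuous_measurable => x; exact: continuous_gamma_integrand.
Qed.

Lemma gamma_integrand_ge0 (p s : R) : 0 <= s `^ p * expR (- s).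
Proof. by rewrite mulr_ge0 ?powR_ge0 ?expR_ge0. Qed.

Lemma egamma_ge0 x : (0 <= egamma x)%E.
Proof. by apply: integral_ge0 => s _; rewrite lee_fin gamma_integrand_ge0. Qed.

(** Integration by parts of s^x against e^(-s) on the exhausting intervals: the boundary term [d n]
    tends to 0 and both integrals converge monotonically. *)
Lemma egammaS (x : R) : 0 < x -> (egamma (x + 1) = x%:E * egamma x)%E.
Proof.
move=> x0.
pose f (s : R) : R := x * s `^ (x - 1) * expR (- s).
pose g (s : R) : R := s `^ x * expR (- s).
have -> : (x%:E * egamma x = \int[mu]_(s in `]0%R, +oo[) (f s)%:E)%E.
  rewrite /egamma -ge0_integralZl//=.
  - by apply: eq_integral => s _; rewrite -EFinM mulrA.
  - apply/measurable_EFinP; exact: measurable_gamma_integrand.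
  - by move=> s _; rewrite lee_fin gamma_integrand_ge0.
  - by rewrite lee_fin ltW.
have mf : measurable_fun `](0:R), +oo[ f.
  apply: pos_continuous_measurable => y y0; apply: continuousM.
    by apply: continuousM; [exact: cst_continuous|exact: continuous_powR_pos].
  exact: continuous_expRN.
rewrite /egamma addrK.
have f0 (s : R) : 0 < s -> (0 <= (f s)%:E)%E.
  by move=> s0; rewrite lee_fin !mulr_ge0 ?powR_ge0 ?expR_ge0// ltW.
have g0 (s : R) : 0 < s -> (0 <= (g s)%:E)%E.
  by move=> s0; rewrite lee_fin gamma_integrand_ge0.
have mg := measurable_gamma_integrand x.
have l1 := @cvg_integral_expn_itv R 1 (EFin \o f) isT.
have {}l1 := l1 (measurableT_comp (@EFin_measurable _ _) mf) f0.
have l2 := @cvg_integral_expn_itv R 1 (EFin \o g) isT.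
have {}l2 := l2 (measurableT_comp (@EFin_measurable _ _) mg) g0.
pose d n : R := g ((n.+1%:R ^+ 1)^-1) - g (n.+1%:R ^+ 1).
have ld : (d n)%:E @[n --> \oo] --> (0%:E : \bar R).
  apply: cvg_EFin; first exact: nearW.
  rewrite -[X in _ --> X](subr0 0).
  by apply: cvgB; [exact: cvg_gamma_integrand0|apply: cvg_gamma_integrandy;
    exact: ltW].
have E : (fun n => \int[mu]_(s in expn_itv 1 n) (EFin \o g) s)%E =
         (fun n => (d n)%:E + \int[mu]_(s in expn_itv 1 n) (EFin \o f) s)%E.
  apply/funext => n; rewrite /expn_itv.
  set a := (n.+1%:R ^+ 1)^-1; set b := n.+1%:R ^+ 1.
  have a0 : 0 < a by rewrite invr_gt0 exprn_gt0.
  (* The interval degenerates to a point for n = 0; there both integrals and [d n] vanish, and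
     integration by parts is kept for a < b. *)
  have [ab|ba] := ltP a b; last first.
    have ab : a = b.
      by apply/eqP; rewrite eq_le ba andbT /a /b expr1 (@le_trans _ _ 1)//
        ?invf_le1 ?ler1n.
    by rewrite /d -/a -/b ab subrr set_itv1 !integral_set1 adde0.
  have cab (h : R -> R) : (forall s : R, 0 < s -> {for s, continuous h}) ->
      {within `[a, b], continuous h}.
    move=> ch; apply: continuous_in_subspaceT => s;
      rewrite inE/= in_itv/= => /andP[as_ _].
    by apply: ch; rewrite (lt_le_trans a0).
  have dab (h dh : R -> R) : (forall s : R, 0 < s -> is_derive s 1 h (dh s)) ->
      derivable_oo_LRcontinuous h a b /\ {in `]a, b[, derive1 h =1 dh}.
    move=> ch; have cth (s : R) : 0 < s -> {for s, continuous h}.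
      move=> s0; apply: differentiable_continuous; apply/derivable1_diffP.
      by have [] := ch _ s0.
    split; first split.
    - move=> s; rewrite in_itv/= => /andP[as_ _].
      by have [] := ch _ (lt_trans a0 as_).
    - by apply: cvg_at_right_filter; exact: cth.
    - by apply: cvg_at_left_filter; apply: cth; rewrite (lt_trans a0).
    - move=> s; rewrite in_itv/= => /andP[as_ _].
      by rewrite derive1E; have [] := ch _ (lt_trans a0 as_).
  have [d1 d1'] := dab (fun s : R => s `^ x) (fun s : R => x * s `^ (x - 1))
    (fun (s : R) s0 => is_derive1_powR x s0).
  have d2 (s : R) : 0 < s -> is_derive s 1 (fun s : R => - expR (- s)) (expR (-
    s)).
    by move=> s0; apply: is_derive_eq; rewrite /= mulrN1 opprK.
  have {d2}[d2 d2'] := dab _ _ d2.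
  rewrite (@integration_by_parts R (fun s : R => s `^ x) (fun s : R => - expR
    (- s))
    (fun s : R => x * s `^ (x - 1)) (fun s : R => expR (- s)))//; first last.
  - by apply: cab => s _; exact: continuous_expRN.
  - apply: cab => s s0; apply: continuousM; first exact: cst_continuous.
    exact: continuous_powR_pos.
  under [X in (_ - X)%E]eq_integral do rewrite mulrN EFinN.
  rewrite integral_ge0N; last first.
    by move=> s; rewrite /= in_itv/= => /andP[/(lt_le_trans a0)/f0].
  by rewrite oppeK; congr (_%:E + _)%E;
    rewrite /d -/a -/b /g !mulrN opprK addrC.
have l3 : ((d n)%:E + \int[mu]_(s in expn_itv 1 n) (EFin \o f) s)%E @[n -->
  \oo] -->
    (0%:E + \int[mu]_(s in `]0%R, +oo[) (EFin \o f) s)%E.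
  by apply: cvgeD => //; rewrite fin_num_adde_defr.
rewrite E in l2; have h := cvg_unique (@ereal_hausdorff R) l2 l3.
by rewrite add0e in h; exact: h.
Qed.

Lemma egamma1 : egamma 1 = 1%E.
Proof.
rewrite /egamma subrr; under eq_integral do rewrite powRr0 mul1r.
have dF (x : R) : is_derive x 1 (fun s : R => - expR (- s)) (expR (- x)).
  by apply: is_derive_eq; rewrite /= mulrN1 opprK.
rewrite integral_itv_obnd_cbnd; last first.
  apply/measurable_EFinP; apply: pos_continuous_measurable => x _.
  exact: continuous_expRN.
rewrite (@ge0_continuous_FTC2y R (fun s => expR (- s)) (fun s => - expR (- s))
  0 0).
- by rewrite oppr0 expR0 -EFinB sub0r opprK.
- by move=> x _; exact: expR_ge0.
- by apply: continuous_subspaceT => x; exact: continuous_expRN.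
- rewrite -[X in _ --> X]oppr0; apply: cvgN; exact: cvgr_expR.
- by move=> x _; have [] := dF x.
- apply: cvg_at_right_filter; apply: cvgN; exact: continuous_expRN.
- by move=> x _; rewrite derive1E; have [] := dF x.
Qed.

Lemma egamma_nat_fin n : (egamma n.+1%:R < +oo)%E.
Proof.
elim: n => [|n ih]; first by rewrite egamma1 ltry.
rewrite -natr1 egammaS ?ltr0n// lte_mul_pinfty// lee_fin ltW//.
Qed.

(** The constant 1 is written as a zeroth power so that, after multiplication by e^(-s), the bound
    is a sum of two gamma integrands. *)
Lemma powR_le_1DpowR (s p q : R) : 0 < s -> 0 <= p <= q ->
  s `^ p <= s `^ 0 + s `^ q.
Proof.
move=> s0 /andP[p0 pq]; have [s1|/ltW s1] := leP s 1.
  by apply: (@le_trans _ _ (s `^ 0)); rewrite ?lerDl ?powR_ge0// ger_powR ?s0.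
by apply: (@le_trans _ _ (s `^ q)); rewrite ?lerDr ?powR_ge0// ler_powR.
Qed.

(** For arguments y >= 1 the integrand is dominated by those of 1 and of an integer above y. For 0 <
    x, the product x [egamma x] equals [egamma (x + 1)], which is finite by the first case. *)
Lemma egamma_lty (x : R) : 0 < x -> (egamma x < +oo)%E.
Proof.
suff H (y : R) : 1 <= y -> (egamma y < +oo)%E.
  move=> x0; have := H (x + 1); rewrite lerDr ltW// => /(_ isT).
  rewrite egammaS//; move: (egamma_ge0 x); case: (egamma x) => [r| |]//.
    by move=> _ _; rewrite ltry.
  by rewrite gt0_muley// ?lte_fin.
move=> y1; pose m := Num.bound y.
have ym : y <= m%:R by apply/ltW; rewrite archi_boundP// (le_trans ler01).
apply: (@le_lt_trans _ _ (egamma 1 + egamma (m.+1%:R))); last first.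
  by apply: lte_add_pinfty; [rewrite egamma1 ltry|exact: egamma_nat_fin].
rewrite /egamma -ge0_integralD//=.
- apply: ge0_le_integral => //=.
  + by move=> s _; rewrite lee_fin gamma_integrand_ge0.
  + by apply/measurable_EFinP; exact: measurable_gamma_integrand.
  + by apply: emeasurable_funD; apply/measurable_EFinP;
      exact: measurable_gamma_integrand.
  + move=> s; rewrite in_itv/= andbT => s0.
    rewrite -EFinD lee_fin -mulrDl ler_wpM2r ?expR_ge0//.
    by rewrite subrr -natr1 addrK powR_le_1DpowR// subr_ge0 y1/= lerBlDr
      ler_wpDr.
- by move=> s _; rewrite lee_fin gamma_integrand_ge0.
- by apply/measurable_EFinP; exact: measurable_gamma_integrand.
- by move=> s _; rewrite lee_fin gamma_integrand_ge0.
- by apply/measurable_EFinP; exact: measurable_gamma_integrand.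
Qed.

Lemma egammaE (x : R) : 0 < x -> egamma x = (Gamma x)%:E.
Proof.
move=> x0; rewrite /Gamma /Rintegral fineK// ge0_fin_numE.
  exact: egamma_lty.
exact: egamma_ge0.
Qed.

Lemma Gamma_ge0 (x : R) : 0 <= Gamma x.
Proof. by apply: Rintegral_ge0 => s _; exact: gamma_integrand_ge0. Qed.

Lemma GammaS (x : R) : 0 < x -> Gamma (x + 1) = x * Gamma x.
Proof.
move=> x0; apply: EFin_inj; rewrite EFinM -!egammaE ?egammaS//.
by rewrite addr_gt0.
Qed.

End gamma.

(** * The coefficients of the series *)

Section coefficients.
Context {R : realType}.

(** A ratio test with stride p: a partial sum S is at most the sum A of the first N + p terms plus S
    / 2, so S <= 2 A. The stride is 5 for the moment series and 1 for the hypergeometric ones. *)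
Lemma cvg_series_half (u : R^nat) (p N : nat) : (forall n, 0 <= u n) ->
  (forall n, (N <= n)%N -> u (n + p)%N <= u n / 2) -> cvgn (series u).
Proof.
move=> u0 up; apply: nondecreasing_is_cvgn.
  by apply/nondecreasing_seqP => n; rewrite /series/= big_nat_recr//= lerDl.
exists (2 * \sum_(0 <= i < N + p) u i) => _ [n _ <-].
have mono a b : \sum_(0 <= i < a) u i <= \sum_(0 <= i < a + b) u i.
  by rewrite [leRHS](@big_cat_nat _ _ _ a)//= ?leq_addr// lerDl sumr_ge0.
apply: (@le_trans _ _ (\sum_(0 <= i < N + p + n) u i)).
  by rewrite addnC; exact: mono.
suff : \sum_(0 <= i < N + p + n) u i <= \sum_(0 <= i < N + p) u i +
    (\sum_(0 <= i < N + p + n) u i) / 2 by lra.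
rewrite [leLHS](@big_cat_nat _ _ _ (N + p))//= ?leq_addr// lerD2l.
apply: (@le_trans _ _ ((\sum_(0 <= i < N + n) u i) / 2)); last first.
  by rewrite ler_pM2r ?invr_gt0// addnAC; exact: mono.
rewrite -{1}(add0n (N + p)%N) big_addn addKn.
apply: (@le_trans _ _ (\sum_(0 <= i < n) u (N + i)%N / 2)).
  by apply: ler_sum => i _; rewrite addnA (addnC i) up ?leq_addr.
rewrite -mulr_suml ler_pM2r ?invr_gt0//.
rewrite [leRHS](@big_cat_nat _ _ _ N)//= ?leq_addr//.
rewrite -{3}(add0n N) big_addn addKn.
under eq_bigr do rewrite addnC.
by rewrite lerDr sumr_ge0.
Qed.

Definition decic_coef (lambda : R) (n : nat) : R :=
  Gamma ((lambda + n%:R + 1) / 5) / 5 / n`!%:R.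

Lemma decic_coef_ge0 lambda n : 0 <= decic_coef lambda n.
Proof. by rewrite /decic_coef !divr_ge0// Gamma_ge0. Qed.

(** The Gamma factor depends only on [lambda + n], and (n+1) / (n+1)! = 1 / n!. *)
Lemma pseries_diffs_decic_coef lambda :
  pseries_diffs (decic_coef lambda) = decic_coef (lambda + 1).
Proof.
apply/funext => n; rewrite /pseries_diffs /decic_coef factS natrM.
rewrite (_ : lambda + n.+1%:R + 1 = lambda + 1 + n%:R + 1); last first.
  by rewrite -natr1; ring.
have n0 : n.+1%:R != 0 :> R by rewrite pnatr_eq0.
have f0 : n`!%:R != 0 :> R by rewrite pnatr_eq0 -lt0n fact_gt0.
field.
by rewrite ?f0 ?natr1 ?nat1r n0.
Qed.

(** Raising [lambda] by 5 raises the Gamma argument by 1; [-1 < lambda] keeps that argument positive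
    for [GammaS]. *)
Lemma decic_coefD5 lambda n : -1 < lambda ->
  decic_coef (lambda + 5) n = (lambda + n%:R + 1) / 5 * decic_coef lambda n.
Proof.
move=> l1; rewrite /decic_coef.
rewrite (_ : (lambda + 5 + n%:R + 1) / 5 = (lambda + n%:R + 1) / 5 + 1);
  last by field.
rewrite GammaS; first by rewrite !mulrA.
rewrite divr_gt0//; have := ler0n R n; lra.
Qed.

(** In the Gamma factor an index shift by 5 is a shift of [lambda] by 5; the denominator is (n+5)! /
    n!. *)
Lemma decic_coef_rec lambda n : -1 < lambda ->
  decic_coef lambda (n + 5) = (lambda + n%:R + 1) / 5 /
    ((n%:R + 1) * (n%:R + 2) * (n%:R + 3) * (n%:R + 4) * (n%:R + 5)) *
      decic_coef lambda n.
Proof.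
move=> l1; rewrite -mulrA mulrCA -decic_coefD5// /decic_coef.
rewrite (_ : lambda + (n + 5)%:R + 1 = lambda + 5 + n%:R + 1); last first.
  by rewrite natrD; ring.
have -> : (n + 5)`! = ((n + 1) * (n + 2) * (n + 3) * (n + 4) * (n + 5) * n`!)%N.
  by rewrite !addnS addn0 !factS; ring.
rewrite !natrM !natrD.
have f0 : n`!%:R != 0 :> R by rewrite pnatr_eq0 -lt0n fact_gt0.
have := ler0n R n; move: (n%:R : R) => x x0.
field; rewrite f0 /=; repeat (apply/andP; split); lra.
Qed.

Lemma is_cvg_pseries_decic_coef lambda t : -1 < lambda ->
  cvgn (pseries (decic_coef lambda) t).
Proof.
move=> l1; apply: normed_cvg.
rewrite /normed_series_of /=.
(* Five steps multiply a term by at most (lambda + n + 1) |t|^5 / (5 (n+1) (n+2)). As lambda + n + 1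
   <= (|lambda| + 1) (n + 1), this is at most 1/2 once M <= n. *)
pose M : R := 2 * (`|lambda| + 1) * `|t| ^+ 5.
apply: (@cvg_series_half _ 5 (Num.bound M)) => // n Mn.
have uE k : `|decic_coef lambda k * t ^+ k| = decic_coef lambda k * `|t| ^+ k.
  by rewrite normrM normrX (ger0_norm (decic_coef_ge0 _ _)).
rewrite !uE.
rewrite decic_coef_rec// exprD.
have M0 : 0 <= M by rewrite !mulr_ge0// ?exprn_ge0// addr_ge0.
have {}Mn : M <= n%:R.
  by apply: (le_trans (ltW (archi_boundP M0))); rewrite ler_nat.
set c := decic_coef lambda n; have c0 : 0 <= c := decic_coef_ge0 _ _.
have tn0 : 0 <= `|t| ^+ n by rewrite exprn_ge0.
have l0 : lambda <= `|lambda| := ler_norm _.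
move: Mn; rewrite /M; have := normr_ge0 lambda.
have : 0 <= `|t| ^+ 5 by rewrite exprn_ge0.
move: (`|t| ^+ 5) => T; move: (`|lambda|) l0 => L l0.
have := ler0n R n; move: (n%:R : R) => x x0 T0 L0 MX.
set D := _ * (x + 5).
have D0 : 0 < D by rewrite /D !mulr_gt0//; lra.
suff H : (lambda + x + 1) / 5 / D * T <= 1 / 2.
  rewrite (_ : _ * c * _ = (lambda + x + 1) / 5 / D * T * (c * `|t| ^+ n));
    last by ring.
  rewrite (_ : _ / 2 = 1 / 2 * (c * `|t| ^+ n)); last by ring.
  by rewrite ler_wpM2r// mulr_ge0.
rewrite mulrAC ler_pdivrMr//.
(* Two of the five factors are enough for the estimate; the product of the others is at least 1. *)
have x2 : (x + 1) * (x + 2) <= D.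
  rewrite /D -[X in X <= _]mulr1 -!mulrA !ler_pM2l; [|lra|lra].
  have : 1 <= (x + 3) * ((x + 4) * (x + 5)) by rewrite -[X in X <= _]mulr1
    ler_pM// ?mulr_ge0//; nra.
  lra.
suff : (lambda + x + 1) * T * 2 <= (x + 1) * (x + 2) * 5 by lra.
have : (L + 1) * T * 2 <= x by lra.
have : (lambda + x + 1) * T <= (L + 1) * (x + 1) * T by apply: ler_wpM2r => //;
  nra.
nra.
Qed.

End coefficients.

(** * Moments *)

Section moments.
Context {R : realType}.
Let mu := @lebesgue_measure R.

Definition decic_integrand (p t s : R) : R := s `^ p * expR (- s ^+ 5 + t * s).

Lemma decic_integrand_ge0 p t s : 0 <= decic_integrand p t s.
Proof. by rewrite mulr_ge0 ?powR_ge0 ?expR_ge0. Qed.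

Lemma continuous_decic_integrand p t (x : R) : 0 < x ->
  {for x, continuous (decic_integrand p t)}.
Proof.
move=> x0; apply: continuousM; first exact: continuous_powR_pos.
apply: (@continuous_comp _ _ _ (fun s : R => - s ^+ 5 + t * s) expR);
  last first.
  exact: continuous_expR.
apply: continuousD; first by apply: continuousN; exact: exprn_continuous.
by apply: continuousM; [exact: cst_continuous|exact: cvg_id].
Qed.

Lemma measurable_decic_integrand p t :
  measurable_fun `](0:R), +oo[ (decic_integrand p t).
Proof.
by apply: pos_continuous_measurable => x; exact: continuous_decic_integrand.
Qed.

(** The right-hand side has the shape produced by the substitution u = s^5, applied to the gamma
    integrand of argument (p + 1) / 5. *)
Lemma decic_integrand0_exp5 (p s : R) : 0 < s -> decic_integrand p 0 s =
  5^-1 * ((s ^+ 5) `^ ((p + 1) / 5 - 1) * expR (- s ^+ 5) * (5 * s ^+ 4)).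
Proof.
move=> s0; rewrite /decic_integrand mul0r addr0.
have sE k : s ^+ k = s `^ k%:R by rewrite powR_mulrn// ltW.
have -> : s `^ p = (s ^+ 5) `^ ((p + 1) / 5 - 1) * s ^+ 4.
  rewrite !sE -powRrM -powRD; last by rewrite (gt_eqF s0) implybT.
  by congr (_ `^ _); field.
by field.
Qed.

Lemma integral_decic_integrand0 p : -1 < p ->
  (\int[mu]_(s in `]0%R, +oo[) (decic_integrand p 0 s)%:E
    = (Gamma ((p + 1) / 5) / 5)%:E)%E.
Proof.
move=> p1.
have x0 : 0 < (p + 1) / 5 by lra.
rewrite (mulrC (Gamma _)) EFinM -egammaE// /egamma.
rewrite (@integration_by_substitution_expn R 4 (fun s : R => s `^ ((p + 1) / 5
  - 1) * expR (- s)));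
  [|by move=> *; exact: continuous_gamma_integrand|by move=> *;
    exact: gamma_integrand_ge0].
rewrite -ge0_integralZl//=; first last.
- move=> s; rewrite in_itv/= andbT => s0; rewrite lee_fin.
  apply: mulr_ge0; first exact: gamma_integrand_ge0.
  by apply: mulr_ge0 => //; apply: exprn_ge0; exact: ltW.
- apply/measurable_EFinP; apply: pos_continuous_measurable => s s0.
  apply: continuousM; last first.
    by apply: continuousM; [exact: cst_continuous|exact: exprn_continuous].
  apply: (@continuous_comp _ _ _ (fun s : R => s ^+ 5)
    (fun s : R => s `^ ((p + 1) / 5 - 1) * expR (- s))).
    exact: exprn_continuous.
  by apply: continuous_gamma_integrand; rewrite exprn_gt0.
- apply: eq_integral => s; rewrite inE/= in_itv/= andbT => s0.
  by rewrite -EFinM decic_integrand0_exp5.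
Qed.

(** The n-th term of the integrand after expansion of e^(ts). The power s^n is absorbed into the
    exponent, so that the integral is a known Gamma value. *)
Definition decic_term (p t : R) (n : nat) (s : R) : R :=
  (t ^+ n / n`!%:R) * decic_integrand (p + n%:R) 0 s.

Lemma decic_termE p t n s : 0 < s ->
  decic_term p t n s = decic_integrand p 0 s * exp_coeff (t * s) n.
Proof.
move=> s0; rewrite /decic_term /decic_integrand /exp_coeff/= powRD ?(gt_eqF s0)
  ?implybT//.
by rewrite powR_mulrn ?(ltW s0)// exprMn; ring.
Qed.

Lemma decic_integrandE p t s :
  decic_integrand p t s = decic_integrand p 0 s * expR (t * s).
Proof. by rewrite /decic_integrand mul0r addr0 expRD mulrA. Qed.

Lemma cvg_decic_term p t s : 0 < s ->
  \sum_(0 <= i < n) decic_term p t i s @[n --> \oo] --> decic_integrand p t s.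
Proof.
move=> s0; under eq_fun do under eq_bigr do rewrite decic_termE//.
under eq_fun do rewrite -mulr_sumr.
rewrite decic_integrandE; apply: cvgM; first exact: cvg_cst.
exact: is_cvg_series_exp_coeff.
Qed.

Lemma measurable_decic_term p t n : measurable_fun `](0:R),
  +oo[ (decic_term p t n).
Proof. by apply: measurable_funM => //; exact: measurable_decic_integrand. Qed.

Lemma integrable_decic_integrand0 p : -1 < p ->
  mu.-integrable `]0, +oo[ (EFin \o decic_integrand p 0).
Proof.
move=> p1; apply/integrableP; split.
  by apply/measurable_EFinP; exact: measurable_decic_integrand.
under eq_integral do rewrite /= ger0_norm ?decic_integrand_ge0//.
by rewrite integral_decic_integrand0// ltry.
Qed.

Lemma integrable_decic_term p t n : -1 < p ->
  mu.-integrable `]0, +oo[ (EFin \o decic_term p t n).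
Proof.
move=> p1; rewrite (_ : EFin \o _ = fun s => ((t ^+ n / n`!%:R)%:E *
  (decic_integrand (p + n%:R) 0 s)%:E)%E).
  by apply: integrableZl => //; apply: integrable_decic_integrand0;
    rewrite ltr_wpDr.
by apply/funext.
Qed.

Lemma integral_decic_term p t n : -1 < p ->
  (\int[mu]_(s in `]0%R, +oo[) (decic_term p t n s)%:E = (decic_coef p n * t ^+
    n)%:E)%E.
Proof.
move=> p1; rewrite /decic_term; under eq_integral do rewrite EFinM.
rewrite integralZl//=; last by apply: integrable_decic_integrand0;
  rewrite ltr_wpDr.
rewrite integral_decic_integrand0 ?ltr_wpDr// -EFinM /decic_coef; congr EFin.
ring.
Qed.

(** For t >= 0 all terms are nonnegative, so sum and integral may be exchanged by monotone
    convergence. *)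
Lemma integral_decic_integrand_ge0 p t : -1 < p -> 0 <= t ->
  (\int[mu]_(s in `]0%R, +oo[) (decic_integrand p t s)%:E
    = (limn (pseries (decic_coef p) t))%:E)%E.
Proof.
move=> p1 t0.
have tm0 n s : 0 <= decic_term p t n s.
  by rewrite /decic_term mulr_ge0 ?decic_integrand_ge0// divr_ge0// exprn_ge0.
transitivity (\int[mu]_(s in `]0%R,
  +oo[) (\sum_(n <oo) (decic_term p t n s)%:E))%E.
  apply: eq_integral => s; rewrite inE/= in_itv/= andbT => s0.
  apply/esym/cvg_lim => //; under eq_fun do rewrite sumEFin.
  apply: cvg_EFin; first exact: nearW.
  exact: cvg_decic_term.
rewrite integral_nneseries//.
- under eq_eseriesr do rewrite integral_decic_term//.
  apply/cvg_lim => //; under eq_fun do rewrite sumEFin.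
  apply: cvg_EFin; first exact: nearW.
  exact: is_cvg_pseries_decic_coef.
- by move=> n; apply/measurable_EFinP; exact: measurable_decic_term.
- by move=> n s _; rewrite lee_fin.
Qed.

(** For t of any sign, the partial sums are bounded in absolute value by the integrand at |t|,
    integrable by the nonnegative case; dominated convergence then allows termwise integration. *)
Lemma integral_decic_integrand p t : -1 < p ->
  mu.-integrable `]0, +oo[ (EFin \o decic_integrand p t) /\
  (\int[mu]_(s in `]0%R, +oo[) (decic_integrand p t s)%:E
    = (limn (pseries (decic_coef p) t))%:E)%E.
Proof.
move=> p1.
have ig : mu.-integrable `]0, +oo[ (EFin \o decic_integrand p `|t|).
  apply/integrableP; split.
    by apply/measurable_EFinP; exact: measurable_decic_integrand.
  under eq_integral do rewrite /= ger0_norm ?decic_integrand_ge0//.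
  by rewrite integral_decic_integrand_ge0// ltry.
have [] := @dominated_convergence _ _ _ mu `]0, +oo[ _
    (fun n => EFin \o (fun s => \sum_(0 <= i < n) decic_term p t i s))
    (EFin \o decic_integrand p t) (EFin \o decic_integrand p `|t|) _ _ _ ig.
- by [].
- by move=> n; apply/measurable_EFinP; apply: measurable_sum => i;
    exact: measurable_decic_term.
- by apply/measurable_EFinP; exact: measurable_decic_integrand.
- apply/aeW => s; rewrite /= in_itv/= andbT => s0.
  by apply: cvg_EFin; [exact: nearW|exact: cvg_decic_term].
- apply/aeW => s n; rewrite /= in_itv/= andbT => s0.
  rewrite lee_fin; apply: (le_trans (ler_norm_sum _ _ _)).
  have dn k : `|decic_term p t k s| = decic_term p `|t| k s.
    rewrite /decic_term normrM (ger0_norm (decic_integrand_ge0 _ _ _)) normrM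
      normrX.
    by rewrite normfV (ger0_norm (ler0n _ _)).
  under eq_bigr do rewrite dn.
  have cv := cvg_decic_term p `|t| s s0.
  rewrite -(cvg_lim _ cv)//; apply: nondecreasing_cvgn_le;
    last by apply/cvg_ex; eexists; exact: cv.
  apply/nondecreasing_seqP => k; rewrite big_nat_recr//= lerDl -dn//.
move=> it _ cv; split => //.
apply: cvg_unique cv _ => //.
rewrite (_ : [sequence _]_n = EFin \o pseries (decic_coef p) t).
  apply: cvg_EFin; first exact: nearW.
  exact: is_cvg_pseries_decic_coef.
apply/funext => n /=.
under eq_integral do rewrite -sumEFin.
rewrite integral_sum//; last by move=> i; exact: integrable_decic_term.
by under eq_bigr do rewrite integral_decic_term//; rewrite sumEFin.
Qed.

End moments.

(** * The moment function: series, derivatives and positivity *)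

Section mu0.
Context {R : realType}.
Let mu := @lebesgue_measure R.

Lemma decic_weight_ge0 (lambda t x : R) : 0 <= decic_weight lambda t x.
Proof. by rewrite mulr_ge0 ?powR_ge0 ?expR_ge0. Qed.

Lemma decic_weightN (lambda t x : R) : decic_weight lambda t (- x) =
  decic_weight lambda t x.
Proof. by rewrite /decic_weight normrN; congr (_ * expR _); ring. Qed.

Lemma measurable_decic_weight (lambda t : R) : measurable_fun [set: R]
  (decic_weight lambda t).
Proof.
apply: measurable_funM.
  apply: (@measurableT_comp _ _ _ _ _ _ (fun y : R => y `^ (2 * lambda + 1)) _
    (fun x : R => `|x|)); last exact: normr_measurable.
  exact: measurable_powR.
apply: measurableT_comp => //; apply: measurable_funD.
  by apply: measurableT_comp => //; exact: exprn_measurable.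
by apply: measurable_funM => //; exact: exprn_measurable.
Qed.

Lemma decic_integrand_sqr (lambda t x : R) : 0 < x ->
  decic_integrand lambda t (x ^+ 2) * (2 * x ^+ 1) = 2 * decic_weight lambda t
    x.
Proof.
move=> x0; rewrite /decic_integrand /decic_weight gtr0_norm// -exprM expr1.
have -> : x `^ (2 * lambda + 1) = (x ^+ 2) `^ lambda * x.
  rewrite powRD ?(gt_eqF x0) ?implybT// powRr1 ?(ltW x0)// powRrM.
  by rewrite (powR_mulrn 2 (ltW x0)).
by ring.
Qed.

(** The weight is even, so the line integral is twice the half-line one; the factor 2 is the one in
    ds = 2x dx for s = x^2. *)
Lemma integral_decic_weight (lambda t : R) :
  (\int[mu]_x (decic_weight lambda t x)%:E =
   \int[mu]_(s in `]0%R, +oo[) (decic_integrand lambda t s)%:E)%E.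
Proof.
have mw := measurable_decic_weight lambda t.
have mwE : measurable_fun [set: R] (EFin \o decic_weight lambda t) by
  exact/measurable_EFinP.
rewrite (@integration_by_substitution_expn R 1 (decic_integrand lambda t));
  [|by move=> *; exact: continuous_decic_integrand|by move=> *;
    exact: decic_integrand_ge0].
rewrite -(setUv `]-oo, (0:R)]%classic) ge0_integral_setU//=; last 4 first.
- exact: measurableC.
- by apply/measurable_EFinP; rewrite setUv.
- by move=> x _; rewrite lee_fin decic_weight_ge0.
- exact/disj_setPCl.
rewrite setCitvl.
rewrite [X in (X + _)%E](_ : _ = \int[mu]_(x in `]0%R,
  +oo[) (decic_weight lambda t x)%:E)%E; last first.
  rewrite integral_itv_obnd_cbnd; last exact: measurable_funTS.
  rewrite (@ge0_integration_by_substitution0 R (EFin \o decic_weight lambda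
    t))//.
    by apply: eq_integral => x _ /=; rewrite decic_weightN.
  by move=> x; rewrite lee_fin decic_weight_ge0.
rewrite -ge0_integralD//=; last 4 first.
- by move=> x _; rewrite lee_fin decic_weight_ge0.
- exact: measurable_funTS.
- by move=> x _; rewrite lee_fin decic_weight_ge0.
- exact: measurable_funTS.
apply: eq_integral => x; rewrite inE/= in_itv/= andbT => x0.
by rewrite -EFinD decic_integrand_sqr// mulr_natl mulr2n.
Qed.

(** The first conjunct records finiteness: [mu0] is the true value of the integral and not a
    default. *)
Lemma mu0E (lambda t : R) : -1 < lambda ->
  (\int[mu]_x (decic_weight lambda t x)%:E = (mu0 lambda t)%:E)%E /\
  mu0 lambda t = limn (pseries (decic_coef lambda) t).
Proof.
move=> l1; rewrite /mu0 /Rintegral integral_decic_weight.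
by have [_ ->] := integral_decic_integrand lambda t l1.
Qed.

(** Termwise differentiation asks for convergence, at a point beyond |t|, of the series and its
    first two formal derivatives; these are the series for [lambda], [lambda + 1] and
    [lambda + 1 + 1]. *)
Lemma is_derive_mu0 (lambda t : R) : -1 < lambda ->
  is_derive t 1 (mu0 lambda) (mu0 (lambda + 1) t).
Proof.
move=> l1; have l2 : -1 < lambda + 1 by lra.
have l3 : -1 < lambda + 1 + 1 by lra.
have -> : mu0 lambda = (fun x => limn (pseries (decic_coef lambda) x)).
  by apply/funext => x; have [_ ->] := mu0E lambda x l1.
have [_ ->] := mu0E (lambda + 1) t l2.
rewrite -pseries_diffs_decic_coef.
apply: (@pseries_snd_diffs _ _ (`|t| + 1)).
- exact: is_cvg_pseries_decic_coef.
- by rewrite pseries_diffs_decic_coef; exact: is_cvg_pseries_decic_coef.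
- by rewrite !pseries_diffs_decic_coef; exact: is_cvg_pseries_decic_coef.
- by rewrite [ltRHS]ger0_norm ?addr_ge0// ltrDl.
Qed.

Lemma derive1_mu0 (lambda : R) : -1 < lambda -> derive1 (mu0 lambda) = mu0
  (lambda + 1).
Proof.
move=> l1; apply/funext => t; rewrite derive1E.
by have [_ ->] := is_derive_mu0 lambda t l1.
Qed.

Lemma derive1n_mu0 (lambda : R) n : -1 < lambda -> derive1n n (mu0 lambda) =
  mu0 (lambda + n%:R).
Proof.
move=> l1; elim: n => [|n ih]; first by rewrite addr0 derive1n0.
rewrite derive1nS ih derive1_mu0 ?ltr_wpDr//.
by rewrite -addrA natr1.
Qed.

(** This is the fifth-order equation in terms of shifts of [lambda]. In [decic_coefD5] the factor
    splits as n / 5 + (lambda + 1) / 5, and the sum of n c_n t^n is t times the derivative. *)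
Lemma mu0D5 (lambda t : R) : -1 < lambda ->
  mu0 (lambda + 5) t = 1 / 5 * t * mu0 (lambda + 1) t + 1 / 5 * (lambda + 1) *
    mu0 lambda t.
Proof.
move=> l1; have l5 : -1 < lambda + 5 by lra.
have l2 : -1 < lambda + 1 by lra.
rewrite !(proj2 (mu0E _ t _))// -pseries_diffs_decic_coef.
have c0 := is_cvg_pseries_decic_coef lambda t l1.
have c1 : cvgn (pseries (pseries_diffs (decic_coef lambda)) t).
  by rewrite pseries_diffs_decic_coef; exact: is_cvg_pseries_decic_coef.
have h := pseries_diffs_equiv c1.
apply/cvg_lim => //.
rewrite (_ : pseries _ t = fun n =>
   1 / 5 * t * series (fun i => i%:R * decic_coef lambda i * t ^+ i.-1) n
   + 1 / 5 * (lambda + 1) * pseries (decic_coef lambda) t n).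
  by apply: cvgD; apply: cvgM => //; exact: cvg_cst.
apply/funext => n; rewrite /pseries/= !mulr_sumr -big_split/=.
apply: eq_bigr => i _; rewrite decic_coefD5//.
case: i => [|i]; first by rewrite mul0r mul0r mulr0 add0r expr0; field.
by rewrite /= [t ^+ i.+1]exprS; field.
Qed.

(** A zero integral would make the weight vanish almost everywhere, yet it is positive on ]0, 1[, of
    measure 1. *)
Lemma mu0_gt0 (lambda t : R) : -1 < lambda -> 0 < mu0 lambda t.
Proof.
move=> l1; rewrite lt0r; apply/andP; split; last first.
  by apply: Rintegral_ge0 => x _; exact: decic_weight_ge0.
apply/eqP => m0.
have [h _] := mu0E lambda t l1; move: h; rewrite m0 => h.
have mw := measurable_decic_weight lambda t.
have mwE : measurable_fun [set: R] (EFin \o decic_weight lambda t) by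
  exact/measurable_EFinP.
have : (\int[mu]_x `|(decic_weight lambda t x)%:E| = 0)%E.
  by under eq_integral do rewrite gee0_abs ?lee_fin ?decic_weight_ge0//.
move/(ae_eq_integral_abs mu measurableT mwE) => [N [mN N0 sN]].
have : (mu `]0%R, 1%R[ <= 0)%E.
  rewrite -N0; apply: le_measure; rewrite ?inE//.
  apply: subset_trans sN => x /=; rewrite in_itv/= => /andP[x0 _] /(_ I)[] /eqP.
  by rewrite gt_eqF// /decic_weight gtr0_norm// mulr_gt0 ?expR_gt0 ?powR_gt0.
by rewrite /mu lebesgue_measure_itv/= lte_fin ltr01 oppr0 adde0 lee_fin ler10.
Qed.

End mu0.

(** * The hypergeometric form *)

Section hypergeometric.
Context {R : realType}.

Definition hyp1F4_term (a b1 b2 b3 b4 z : R) (k : nat) : R :=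
  pochhammer a k
     / (pochhammer b1 k * pochhammer b2 k * pochhammer b3 k * pochhammer b4 k)
   * (z ^+ k / k`!%:R).

Lemma pochhammerS (a : R) k : pochhammer a k.+1 = pochhammer a k * (a + k%:R).
Proof. by rewrite /pochhammer big_ord_recr. Qed.

Lemma pochhammer_gt0 (b : R) k : 0 < b -> 0 < pochhammer b k.
Proof. by move=> b0; apply: prodr_gt0 => i _; rewrite ltr_wpDr. Qed.

Lemma hyp1F4_term0 (a b1 b2 b3 b4 z : R) : hyp1F4_term a b1 b2 b3 b4 z 0 = 1.
Proof. by rewrite /hyp1F4_term /pochhammer !big_ord0 expr0 fact0; field. Qed.

Lemma hyp1F4_termS (a b1 b2 b3 b4 z : R) k : 0 < b1 -> 0 < b2 -> 0 < b3 -> 0 <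
  b4 ->
  hyp1F4_term a b1 b2 b3 b4 z k.+1 = hyp1F4_term a b1 b2 b3 b4 z k *
   ((a + k%:R) * z / ((b1 + k%:R) * (b2 + k%:R) * (b3 + k%:R) * (b4 + k%:R) *
     (1 + k%:R))).
Proof.
move=> b10 b20 b30 b40; rewrite /hyp1F4_term !pochhammerS factS natrM exprS
  -nat1r.
have p1 := pochhammer_gt0 _ k b10; have p2 := pochhammer_gt0 _ k b20.
have p3 := pochhammer_gt0 _ k b30; have p4 := pochhammer_gt0 _ k b40.
have f0 : 0 < k`!%:R :> R by rewrite ltr0n fact_gt0.
have k0 := ler0n R k.
move: (pochhammer a k) (pochhammer b1 k) (pochhammer b2 k) (pochhammer b3 k)
  (pochhammer b4 k) (k`!%:R : R) (k%:R : R) (z ^+ k) p1 p2 p3 p4 f0 k0.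
move=> pa q1 q2 q3 q4 f x zk p1 p2 p3 p4 f0 x0.
by field; repeat (apply/andP; split); lra.
Qed.

Lemma is_cvg_hyp1F4 (a b1 b2 b3 b4 z : R) : 0 < b1 -> 0 < b2 -> 0 < b3 -> 0 <
  b4 ->
  cvgn (series (hyp1F4_term a b1 b2 b3 b4 z)).
Proof.
move=> b10 b20 b30 b40; apply: normed_cvg; rewrite /normed_series_of /=.
pose M : R := 2 * (`|a| + 1) * `|z|.
(* The bound n >= 1 makes every b_i + n at least 1, so the denominator of the term ratio is at least
   n (1 + n); M <= n then brings the ratio down to 1/2. *)
apply: (@cvg_series_half R _ 1 (maxn 1 (Num.bound M))) => // n.
rewrite geq_max => /andP[n1 Mn].
have M0 : 0 <= M by rewrite !mulr_ge0// addr_ge0.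
have {}Mn : M <= n%:R.
  by apply: (le_trans (ltW (archi_boundP M0))); rewrite ler_nat.
have {}n1 : 1 <= n%:R :> R by rewrite ler1n.
rewrite addn1 hyp1F4_termS// normrM ler_wpM2l//.
move: (n%:R : R) n1 Mn => x x1; rewrite /M => Mx.
set D := _ * (1 + x).
have D0 : 0 < D by rewrite /D !mulr_gt0//; lra.
rewrite normrM normfV (gtr0_norm D0) ler_pdivrMr// normrM.
have Dx : x * (1 + x) <= D.
  rewrite /D ler_pM2r; last lra.
  have h (b : R) : 0 < b -> 1 <= b + x by lra.
  have xb : x <= b1 + x by lra.
  rewrite -[leLHS]mulr1; apply: ler_pM; [lra|lra| |exact: h].
  rewrite -[leLHS]mulr1; apply: ler_pM; [lra|lra| |exact: h].
  by rewrite -[leLHS]mulr1; apply: ler_pM; [lra|lra|lra|exact: h].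
apply: (@le_trans _ _ (2^-1 * (x * (1 + x))));
  last by rewrite ler_pM2l// invr_gt0.
have ax : `|a + x| <= (`|a| + 1) * (1 + x).
  apply: (le_trans (ler_normD _ _)); rewrite [`|x|]ger0_norm; last lra.
  by have := normr_ge0 a; nra.
apply: (@le_trans _ _ ((`|a| + 1) * (1 + x) * `|z|));
  first by rewrite ler_wpM2r.
nra.
Qed.

(** The terms of index congruent to j modulo 5 have the hypergeometric term ratio. The polynomial
    identity says that b_1, ..., b_4 and 1 are the numbers (j+1)/5, ..., (j+5)/5; the entry 1
    supplies the k!. *)
Lemma decic_coef_hyp1F4_term (lambda t b1 b2 b3 b4 : R) (j k : nat) : -1 <
  lambda ->
  0 < b1 -> 0 < b2 -> 0 < b3 -> 0 < b4 ->
  (forall x, (b1 + x) * (b2 + x) * (b3 + x) * (b4 + x) * (1 + x) * 5 ^+ 5 =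
    (5 * x + j%:R + 1) * (5 * x + j%:R + 2) * (5 * x + j%:R + 3) *
    (5 * x + j%:R + 4) * (5 * x + j%:R + 5)) ->
  decic_coef lambda (5 * k + j) * t ^+ (5 * k + j) =
  decic_coef lambda j * t ^+ j *
    hyp1F4_term ((lambda + j%:R + 1) / 5) b1 b2 b3 b4 ((t / 5) ^+ 5) k.
Proof.
move=> l1 b10 b20 b30 b40 Hb; elim: k => [|k ih].
  by rewrite hyp1F4_term0 mulr1 muln0 add0n.
rewrite hyp1F4_termS// mulrA -ih mulnSr addnAC decic_coef_rec//.
rewrite exprD natrD natrM.
move: (decic_coef _ _) (t ^+ (5 * k + j)) => c T.
have := Hb k%:R; have := ler0n R k; have := ler0n R j.
move: (k%:R : R) (j%:R : R) => x y y0 x0 {}Hb.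
have -> : (b1 + x) * (b2 + x) * (b3 + x) * (b4 + x) * (1 + x) =
    (5 * x + y + 1) * (5 * x + y + 2) * (5 * x + y + 3) *
    (5 * x + y + 4) * (5 * x + y + 5) / 5 ^+ 5.
  by rewrite -Hb; field.
by field; repeat (apply/andP; split); lra.
Qed.

Lemma series_decimate (u : R^nat) n :
  series u (5 * n)%N = \sum_(j < 5) series (fun k => u (5 * k + j)%N) n.
Proof.
elim: n => [|n ih].
  by rewrite muln0 /series/= big_nil big1// => j _; rewrite big_nil.
rewrite mulnSr /series/=.
under [RHS]eq_bigr do rewrite big_nat_recr//=.
rewrite big_split/= -[X in _ = X + _]ih /series/=.
rewrite (@big_cat_nat _ _ _ (5 * n))//= ?leq_addr//; congr (_ + _).
by rewrite -{1}(add0n (5 * n)%N) big_addn addKn big_mkord;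
  apply: eq_bigr => i _; rewrite addnC.
Qed.

Lemma mu0_hyp1F4 (lambda t : R) : -1 < lambda ->
  mu0 lambda t =
          1 / 5 * Gamma (lambda / 5 + 1 / 5)
            * hyp1F4 (lambda / 5 + 1 / 5)
                (1 / 5) (2 / 5) (3 / 5) (4 / 5) ((t / 5) ^+ 5)
        + 1 / 5 * t * Gamma (lambda / 5 + 2 / 5)
            * hyp1F4 (lambda / 5 + 2 / 5)
                (2 / 5) (3 / 5) (4 / 5) (6 / 5) ((t / 5) ^+ 5)
        + 1 / 10 * t ^+ 2 * Gamma (lambda / 5 + 3 / 5)
            * hyp1F4 (lambda / 5 + 3 / 5)
                (3 / 5) (4 / 5) (6 / 5) (7 / 5) ((t / 5) ^+ 5)
        + 1 / 30 * t ^+ 3 * Gamma (lambda / 5 + 4 / 5)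
            * hyp1F4 (lambda / 5 + 4 / 5)
                (4 / 5) (6 / 5) (7 / 5) (8 / 5) ((t / 5) ^+ 5)
        + 1 / 120 * t ^+ 4 * Gamma (lambda / 5 + 1)
            * hyp1F4 (lambda / 5 + 1)
                (6 / 5) (7 / 5) (8 / 5) (9 / 5) ((t / 5) ^+ 5).
Proof.
move=> l1; rewrite (proj2 (mu0E lambda t l1)).
have cv := is_cvg_pseries_decic_coef lambda t l1.
(* The limit may be taken along partial sums of length 5n, which split exactly into the five residue
   classes. *)
have c5 : (5 * n)%N @[n --> \oo] --> \oo.
  by move=> P [M _ MP]; exists M => // n Mn; apply: MP;
    rewrite /= (leq_trans Mn)// leq_pmull.
have {}cv := cvg_comp _ _ c5 cv.
apply: (cvg_unique _ cv); first exact: norm_hausdorff.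
have block (j : nat) (b1 b2 b3 b4 : R) : 0 < b1 -> 0 < b2 -> 0 < b3 -> 0 < b4 ->
  (forall x, (b1 + x) * (b2 + x) * (b3 + x) * (b4 + x) * (1 + x) * 5 ^+ 5 =
    (5 * x + j%:R + 1) * (5 * x + j%:R + 2) * (5 * x + j%:R + 3) *
    (5 * x + j%:R + 4) * (5 * x + j%:R + 5)) ->
  series (fun k => decic_coef lambda (5 * k + j) * t ^+ (5 * k + j)) @ \oo -->
  decic_coef lambda j * t ^+ j *
    hyp1F4 ((lambda + j%:R + 1) / 5) b1 b2 b3 b4 ((t / 5) ^+ 5).
  move=> b10 b20 b30 b40 Hb.
  under eq_fun do rewrite (decic_coef_hyp1F4_term lambda t b1 b2 b3 b4)//.
  rewrite (_ : series _ = fun n => decic_coef lambda j * t ^+ j * series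
    (hyp1F4_term ((lambda + j%:R + 1) / 5) b1 b2 b3 b4 ((t / 5) ^+ 5)) n);
      last first.
    by apply/funext => n; rewrite /series/= mulr_sumr.
  by apply: cvgM; [exact: cvg_cst|exact: is_cvg_hyp1F4].
pose S j := series (fun k => decic_coef lambda (5 * k + j) * t ^+ (5 * k + j)).
rewrite (_ : _ \o _ = fun n => S 0%N n + S 1%N n + S 2%N n + S 3%N n + S 4%N
  n); last first.
  apply/funext => n /=; rewrite /pseries series_decimate.
  by rewrite !big_ord_recr big_ord0/= add0r.
(* The values d = j! = 1, 1, 2, 6, 24 yield the prefactors 1/5, 1/5, 1/10, 1/30, 1/120. *)
have K j (d : R) : (j`!%:R : R) = d -> decic_coef lambda j * t ^+ j =
    t ^+ j / d / 5 * Gamma ((lambda + j%:R + 1) / 5).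
  by move=> <-; rewrite /decic_coef; ring.
apply: cvgD; first (apply: cvgD; first (apply: cvgD; first apply: cvgD)).
- have := block 0%N (1/5) (2/5) (3/5) (4/5).
  rewrite (K _ 1)//.
  rewrite (_ : (lambda + 0%:R + 1) / 5 = lambda / 5 + 1 / 5); last by ring.
  rewrite (_ : t ^+ 0 / 1 / 5 = 1 / 5); last by field.
  apply; [lra|lra|lra|lra|by move=> x; field].
- have := block 1%N (2/5) (3/5) (4/5) (6/5).
  rewrite (K _ 1)//.
  rewrite (_ : (lambda + 1%:R + 1) / 5 = lambda / 5 + 2 / 5); last by ring.
  rewrite (_ : t ^+ 1 / 1 / 5 = 1 / 5 * t); last by field.
  apply; [lra|lra|lra|lra|by move=> x; field].
- have := block 2%N (3/5) (4/5) (6/5) (7/5).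
  rewrite (K _ 2)//.
  rewrite (_ : (lambda + 2%:R + 1) / 5 = lambda / 5 + 3 / 5); last by ring.
  rewrite (_ : t ^+ 2 / 2 / 5 = 1 / 10 * t ^+ 2); last by field.
  apply; [lra|lra|lra|lra|by move=> x; field].
- have := block 3%N (4/5) (6/5) (7/5) (8/5).
  rewrite (K _ 6)//.
  rewrite (_ : (lambda + 3%:R + 1) / 5 = lambda / 5 + 4 / 5); last by ring.
  rewrite (_ : t ^+ 3 / 6 / 5 = 1 / 30 * t ^+ 3); last by field.
  apply; [lra|lra|lra|lra|by move=> x; field].
- have := block 4%N (6/5) (7/5) (8/5) (9/5).
  rewrite (K _ 24)//.
  rewrite (_ : (lambda + 4%:R + 1) / 5 = lambda / 5 + 1); last by field.
  rewrite (_ : t ^+ 4 / 24 / 5 = 1 / 120 * t ^+ 4); last by field.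
  apply; [lra|lra|lra|lra|by move=> x; field].
Qed.

End hypergeometric.

(** * Orthogonal polynomials *)

Section hankel.
Context {F : fieldType} (L : {poly F} -> F).
Hypothesis LD : forall p q : {poly F}, L (p + q) = L p + L q.
Hypothesis LZ : forall c (p : {poly F}), L (c *: p) = c * L p.
Hypothesis L_neq0 : forall p : {poly F}, p != 0 -> L (p * p) != 0.

Let L0 : L 0 = 0.
Proof. by rewrite -(scale0r 0) LZ mul0r. Qed.

Let rVpolyE n (v : 'rV[F]_n) : rVpoly v = \sum_(i < n) v 0 i *: 'X^i.
Proof. by rewrite /rVpoly poly_def; apply: eq_bigr => i _; rewrite valK. Qed.

Let L_mul_rVpoly n p (v : 'rV[F]_n) :
  L (p * rVpoly v) = \sum_(i < n) v 0 i * L (p * 'X^i).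
Proof.
rewrite rVpolyE mulr_sumr (big_morph L LD L0).
by apply: eq_bigr => i _; rewrite -scalerAr LZ.
Qed.

Let hankel n : 'M[F]_n := \matrix_(i, j) L ('X^i * 'X^j).

Let mul_hankel n (v : 'rV[F]_n) j : (v *m hankel n) 0 j = L ('X^j * rVpoly v).
Proof.
by rewrite mxE L_mul_rVpoly; apply: eq_bigr => i _; rewrite mxE (mulrC 'X^j).
Qed.

(** A vector in the left kernel, read as a polynomial r, satisfies L(X^j r) = 0 for all j < n, hence
    L(r r) = 0, which forces r = 0. *)
Let hankel_unit n : hankel n \in unitmx.
Proof.
rewrite -row_free_unit -kermx_eq0; apply/eqP/row_matrixP => i; rewrite row0.
set u := row i _.
have uH : u *m hankel n = 0 by rewrite -row_mul mulmx_ker row0.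
apply: (can_inj (@rVpolyK _ _)); rewrite linear0.
apply/eqP; apply: contraT => /L_neq0; rewrite L_mul_rVpoly big1 ?eqxx// => j _.
by rewrite mulrC (mulrC (rVpoly u)) -mul_hankel uH mxE mul0r.
Qed.

Lemma exists_monic_orthogonal n : exists p : {poly F},
  [/\ p \is monic, size p = n.+1 &
      forall q : {poly F}, (size q <= n)%N -> L (p * q) = 0].
Proof.
(* Orthogonality of X^n + r to every X^j with j < n is the linear system v H = b for the
   coefficients v of r, H being the Hankel matrix. *)
pose b : 'rV[F]_n := \row_j - L ('X^j * 'X^n).
pose r := rVpoly (b *m invmx (hankel n)).
have szr : (size r < size ('X^n : {poly F}))%N by rewrite size_polyXn ltnS
  size_poly.
exists ('X^n + r); split.
- by rewrite monicE lead_coefDl// lead_coefXn.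
- by rewrite size_polyDl// size_polyXn.
- move=> q qn; rewrite -(poly_rV_K qn) L_mul_rVpoly big1// => i _.
  rewrite mulrC (mulrC _ 'X^i) mulrDr LD -mul_hankel mulmxKV ?hankel_unit//.
  by rewrite mxE subrr mul0r.
Qed.

Lemma exists_orthogonal_family : exists P : nat -> {poly F},
  (forall n, P n \is monic /\ size (P n) = n.+1) /\
  (forall m n, m <> n -> L (P m * P n) = 0).
Proof.
have [P PP] := choice exists_monic_orthogonal.
exists P; split=> [n|m n /eqP]; first by have [] := PP n.
rewrite neq_ltn => /orP[] mn; [rewrite mulrC|].
  by have [_ _ ->//] := PP n; have [_ -> _] := PP m.
by have [_ _ ->//] := PP m; have [_ -> _] := PP n.
Qed.

End hankel.

(** * The first recurrence coefficient of a symmetric functional *)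

Section recurrence.
Context {F : fieldType} (L : {poly F} -> F).
Hypothesis LD : forall p q : {poly F}, L (p + q) = L p + L q.
Hypothesis LZ : forall c (p : {poly F}), L (c *: p) = c * L p.
Hypothesis L1_neq0 : L 1 != 0.
Hypothesis L2_neq0 : L 'X^2 != 0.
Hypothesis Lodd1 : L 'X = 0.
Hypothesis Lodd3 : L 'X^3 = 0.

Lemma monic_size1 (p : {poly F}) : p \is monic -> size p = 1%N -> p = 1.
Proof.
move=> /monicP pm sp; have /size1_polyC pE : (size p <= 1)%N by rewrite sp.
by move: pm; rewrite lead_coefE sp pE coefC/= => ->.
Qed.

Lemma monic_size2 (p : {poly F}) : p \is monic -> size p = 2%N -> p = 'X +
  (p`_0)%:P.
Proof.
move=> /monicP pm sp; move: pm; rewrite lead_coefE sp/= => p1.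
apply/polyP => -[|[|i]]; rewrite coefD coefX coefC/= ?add0r ?addr0//.
by rewrite nth_default// sp.
Qed.

Lemma monic_size3 (p : {poly F}) : p \is monic -> size p = 3%N ->
  p = 'X^2 + p`_1 *: 'X + (p`_0)%:P.
Proof.
move=> /monicP pm sp; move: pm; rewrite lead_coefE sp/= => p2.
apply/polyP => -[|[|[|i]]]; rewrite !coefD coefZ coefX coefXn coefC/= ?(mulr0,
  mulr1, add0r, addr0)//.
by rewrite nth_default// sp.
Qed.

(** Orthogonality to 1 gives P_1 = X, since L(X) = 0. In P_2 = X^2 + dX + e, orthogonality to X
    kills d because L(X) = L(X^3) = 0, and orthogonality to 1 fixes e. Any orthogonal family thus
    has the same coefficient. *)
Lemma orthogonal_recurrence (P : nat -> {poly F}) :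
  (forall n, P n \is monic /\ size (P n) = n.+1) ->
  (forall m n, m <> n -> L (P m * P n) = 0) ->
  P 2%N = 'X * P 1%N - (L 'X^2 / L 1) *: P 0%N /\ P 0%N = 1.
Proof.
move=> Pm Po.
have P0 : P 0%N = 1 by have [] := Pm 0%N; exact: monic_size1.
have P1 : P 1%N = 'X.
  have [m1 s1] := Pm 1%N; have := Po 1%N 0%N ltac:(by []).
  rewrite P0 mulr1 (monic_size2 _ m1 s1) LD Lodd1 add0r -[_%:P]mulr1 mul_polyC
    LZ.
  move=> /eqP; rewrite mulf_eq0 (negbTE L1_neq0) orbF => /eqP ->.
  by rewrite scale0r addr0.
split=> //; have [m2 s2] := Pm 2%N; have h0 := Po 2%N 0%N ltac:(by []);
  have h1 := Po 2%N 1%N ltac:(by []).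
move: h0 h1; rewrite P0 P1 mulr1 (monic_size3 _ m2 s2).
move: (P 2%N)`_1 (P 2%N)`_0 => d e.
rewrite !mulrDl -exprSr -scalerAl -!expr2 mul_polyC !LD !LZ Lodd1 Lodd3.
rewrite !mulr0 !addr0 add0r -(alg_polyC e) LZ => h0 /eqP.
rewrite mulf_eq0 (negbTE L2_neq0) orbF => /eqP ->.
rewrite scale0r addr0; congr (_ + _); rewrite -scaleNr; congr (_ *: _).
by apply: (mulIf L1_neq0); rewrite mulNr divfK//; apply/eqP;
  rewrite -addr_eq0 addrC h0.
Qed.
End recurrence.

(** * The coefficient [beta1] as a quotient of moments *)

Section beta1.
Context {R : realType} (lambda t : R).
Hypothesis l1 : -1 < lambda.
Let mu := @lebesgue_measure R.
Let w := decic_weight lambda t.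

Lemma normrX_decic_weight n (x : R) :
  `|x| ^+ n * w x = decic_weight (lambda + n%:R / 2) t x.
Proof.
rewrite /w /decic_weight mulrA; congr (_ * _).
have -> : 2 * (lambda + n%:R / 2) + 1 = n%:R + (2 * lambda + 1) by field.
have [->|x0] := eqVneq x 0; last first.
  by rewrite [in RHS]powRD ?normr_eq0 ?x0 ?implybT// powR_mulrn.
(* At x = 0 powers do not add in general; for positive n both sides are 0, the total exponent being
   positive by [-1 < lambda]. *)
case: n => [|n]; first by rewrite expr0 mul1r add0r.
rewrite normr0 expr0n/= mul0r powR0// gt_eqF// -(natr1 n).
by have := ler0n R n; have := l1; lra.
Qed.

Lemma integrable_decic_weight (a : R) : -1 < a ->
  mu.-integrable setT (EFin \o decic_weight a t).
Proof.
move=> a1; apply/integrableP; split.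
  by apply/measurable_EFinP; exact: measurable_decic_weight.
under eq_integral do rewrite /= ger0_norm ?decic_weight_ge0//.
by rewrite (proj1 (mu0E a t a1)) ltry.
Qed.

Lemma integrable_exprn_decic_weight n :
  mu.-integrable setT (EFin \o (fun x : R => x ^+ n * w x)).
Proof.
have an : -1 < lambda + n%:R / 2 by have := ler0n R n; have := l1; lra.
apply: le_integrable (integrable_decic_weight _ an) => //.
  apply/measurable_EFinP; apply: measurable_funM; first exact: exprn_measurable.
  exact: measurable_decic_weight.
move=> x _ /=; rewrite -normrX_decic_weight lee_fin.
by rewrite normrM normrX (ger0_norm (decic_weight_ge0 _ _ _)) ler_norm.
Qed.

Lemma integrable_poly_decic_weight (p : {poly R}) :
  mu.-integrable setT (EFin \o (fun x : R => p.[x] * w x)).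
Proof.
rewrite (_ : EFin \o _ = (fun x : R =>
    \sum_(i < size p) ((p`_i)%:E * (x ^+ i * w x)%:E))%E); last first.
  apply/funext => x /=; rewrite horner_coef mulr_suml -sumEFin.
  by apply: eq_bigr => i _; rewrite -EFinM (mulrA p`_i).
apply: integrable_sum => // i _; apply: integrableZl => //.
exact: integrable_exprn_decic_weight.
Qed.

Definition decic_functional (p : {poly R}) : R := \int[mu]_x (p.[x] * w x).
Let L := decic_functional.

Lemma integral_poly_decic_weight (p : {poly R}) :
  (\int[mu]_x (p.[x] * w x)%:E = (L p)%:E)%E.
Proof.
rewrite /L /decic_functional /Rintegral fineK//.
exact: (integrable_fin_num _ (integrable_poly_decic_weight p)).
Qed.

Let LD (p q : {poly R}) : L (p + q) = L p + L q.
Proof.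
rewrite /L /decic_functional -RintegralD//;
  [|exact: integrable_poly_decic_weight..].
by apply: eq_Rintegral => x _; rewrite hornerD mulrDl.
Qed.

Let LZ c (p : {poly R}) : L (c *: p) = c * L p.
Proof.
rewrite /L /decic_functional -RintegralZl//;
  last exact: integrable_poly_decic_weight.
by apply: eq_Rintegral => x _; rewrite hornerZ -(mulrA c).
Qed.

Lemma finite_roots (p : {poly R}) : p != 0 -> finite_set [set x | root p x].
Proof.
move=> p0; apply: contrapT => /(infinite_set_fset (size p))[B Bp].
rewrite leqNgt => /negP; apply; apply: max_poly_roots => //.
- by apply/allP => x xB; exact: Bp.
- exact: finmap.fset_uniq.
Qed.

(** If L(p p) = 0 then p^2 w vanishes almost everywhere, so ]0, 1[ is covered by a null set and the
    finitely many roots of p, contradicting its measure 1. *)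
Let L_neq0 (p : {poly R}) : p != 0 -> L (p * p) != 0.
Proof.
move=> p0; apply/eqP => Lp0.
have ip := integrable_poly_decic_weight (p * p).
have mp : measurable_fun [set: R] (EFin \o (fun x : R => (p * p).[x] * w x)).
  exact: (measurable_int _ ip).
have : (\int[mu]_x `|((p * p).[x] * w x)%:E| = 0)%E.
  under eq_integral => x _.
    rewrite gee0_abs; last first.
      by rewrite lee_fin hornerM mulr_ge0 ?decic_weight_ge0// -expr2 sqr_ge0.
    over.
  by rewrite integral_poly_decic_weight Lp0.
move/(ae_eq_integral_abs mu measurableT mp) => [N [mN N0 sN]].
have fr := finite_roots _ p0.
have r0 := countable_lebesgue_measure0 (finite_set_countable fr).
have mr : measurable ([set x | root p x] : set R) by apply:
  countable_measurable; last exact: finite_set_countable.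
have : (mu `]0%R, 1%R[ <= 0)%E.
  apply: (@le_trans _ _ (mu (N `|` [set x | root p x]))%E).
    apply: le_measure; rewrite ?inE//; first exact: measurableU.
    move=> x /=; rewrite in_itv/= => /andP[x0 _].
    have [px|px] := boolP (root p x); [by right|left].
    apply: sN => /= /(_ I)[] /eqP.
    rewrite hornerM; apply/negP; apply: mulf_neq0; first exact: mulf_neq0.
    by rewrite gt_eqF// /w /decic_weight gtr0_norm// mulr_gt0 ?expR_gt0
      ?powR_gt0.
  apply: (@le_trans _ _ (mu N + mu [set x | root p x])%E);
    first exact: measureU2.
  have -> : mu N = 0%E by exact: N0.
  by rewrite add0e; have -> : mu [set x | root p x] = 0%E by exact: r0.
by rewrite /mu lebesgue_measure_itv/= lte_fin ltr01 oppr0 adde0 lee_fin ler10.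
Qed.

(** Reflection preserves Lebesgue measure and changes the sign of the integrand, so the integral
    equals its own opposite. *)
Let Lodd n : odd n -> L 'X^n = 0.
Proof.
move=> on; have ip := integrable_poly_decic_weight 'X^n.
suff : L 'X^n = - L 'X^n by lra.
apply: EFin_inj; rewrite EFinN -!integral_poly_decic_weight.
pose f (x : R) : R := ('X^n).[x] * w x.
have mf : measurable_fun [set: R] (EFin \o f) := measurable_int _ ip.
have fN x : f (- x) = - f x.
  by rewrite /f !hornerXn exprNn -signr_odd on expr1 mulN1r mulNr /w
    decic_weightN.
have ifN : mu.-integrable [set: R] ((EFin \o f) \o -%R).
  rewrite (_ : _ \o _ = \- (EFin \o f))%E; last by apply/funext => x /=;
    rewrite fN.
  exact: integrableN.
transitivity (\int[pushforward mu (-%R : _ -> measurableTypeR R)]_x (f x)%:E)%E.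
  by apply: eq_measure_integral => A mA _; exact/esym/lebesgue_measureN.
rewrite integral_pushforward// preimage_setT.
under eq_integral do rewrite /= fN EFinN.
by rewrite integralN//; exact: (integrable_add_def measurableT ip).
Qed.

Let L1 : L 1 = mu0 lambda t.
Proof. by apply: eq_Rintegral => x _; rewrite -[1]/(1%:P) hornerC mul1r. Qed.

Let L2 : L 'X^2 = mu0 (lambda + 1) t.
Proof.
(* The 1 in [lambda + 1] is written 2 / 2 to fit [normrX_decic_weight] with n = 2. *)
apply: eq_Rintegral => x _; rewrite hornerXn -[in RHS](divff (_ : (2:R) !=
  0))//.
by rewrite -normrX_decic_weight real_normK// num_real.
Qed.

(** The choice in [recurrence_coeff] is pinned down by existence, from the Hankel construction, and
    uniqueness, from [orthogonal_recurrence]; its default value is never reached. *)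
Lemma beta1E : beta1 lambda t = mu0 (lambda + 1) t / mu0 lambda t.
Proof.
have L1n0 : L 1 != 0 by rewrite L1 gt_eqF// mu0_gt0.
have L2n0 : L 'X^2 != 0 by rewrite L2 gt_eqF// mu0_gt0//; have := l1; lra.
(* Polynomials are integrable against the weight, so extended-real orthogonality is orthogonality
   for L. *)
have oP P : monic_orthogonal w P <-> (forall n,
  P n \is monic /\ size (P n) = n.+1) /\
    (forall m n, m <> n -> L (P m * P n) = 0).
  split=> -[Pm Po]; split=> // m n mn; have := Po m n mn.
    under eq_integral do rewrite -hornerM.
    by rewrite integral_poly_decic_weight => -[].
  under eq_integral do rewrite -hornerM.
  by rewrite integral_poly_decic_weight => ->.
have rec P : monic_orthogonal w P ->
    P 2%N = 'X * P 1%N - (L 'X^2 / L 1) *: P 0%N /\ P 0%N = 1.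
  move=> /oP[Pm Po].
  by apply: (@orthogonal_recurrence _ L) => //; [rewrite -['X]expr1|];
    exact: Lodd.
rewrite -L1 -L2 /beta1 /recurrence_coeff; apply: xget_unique.
  have [P PP] := exists_orthogonal_family L LD LZ L_neq0.
  by exists P; [exact/oP|have [] := rec P (proj2 (oP P) PP)].
move=> b /= [P mP Pb]; have [Pc P0] := rec P mP.
move: Pb; rewrite Pc => /addrI/oppr_inj; rewrite P0 !alg_polyC => /polyC_inj.
exact/esym.
Qed.

End beta1.

(** * The equations for beta1 *)

(* If [r k] is the [k]-th moment of a probability measure and the exponential
   tilt by [t] acts as [r_k' = r_(k+1) - r_k r_1], these are the cumulants
   [kappa_1, ..., kappa_5], each the derivative of the previous one. *)
Definition cumulant {R : realType} (r : nat -> R -> R) (k : nat) : R -> R :=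
  match k with
  | 0 => r 1
  | 1 => r 2 - r 1 ^+ 2
  | 2 => r 3 - 3 *: (r 1 * r 2) + 2 *: r 1 ^+ 3
  | 3 => r 4 - 4 *: (r 1 * r 3) - 3 *: r 2 ^+ 2 + 12 *: (r 1 ^+ 2 * r 2) - 6 *:
    r 1 ^+ 4
  | _ => r 5 - 5 *: (r 1 * r 4) - 10 *: (r 2 * r 3) + 20 *: (r 1 ^+ 2 * r 3)
      + 30 *: (r 1 * r 2 ^+ 2) - 60 *: (r 1 ^+ 3 * r 2) + 24 *: r 1 ^+ 5
  end%R.

(** The rule for [r k] determines the derivative of any polynomial in the [r k]; each case is then a
    ring identity. The bound [k < 4] reflects that [cumulant] stays at the fifth cumulant from index
    4 on. *)
Lemma is_derive_cumulant {R : realType} (r : nat -> R -> R) :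
  (forall k (t : R), is_derive t 1 (r k) (r k.+1 t - r k t * r 1 t)) ->
  forall k (t : R), (k < 4)%N -> is_derive t 1 (cumulant r k) (cumulant r k.+1
    t).
Proof.
move=> dr k t.
have := (dr 1 t, dr 2 t, dr 3 t, dr 4 t); rewrite /cumulant.
move: (r 1) (r 2) (r 3) (r 4) (r 5) => r1 r2 r3 r4 r5 [[[d1 d2] d3] d4].
have X n (f : R -> R) df (df' : is_derive t 1 f df) :
    is_derive t 1 (f ^+ n) ((n%:R * f t ^+ n.-1) *: df) by exact: is_deriveX.
case: k => [|[|[|[|//]]]] _ /=.
- by apply: (is_derive_eq d1); rewrite !fctE; ring.
- apply: (is_derive_eq (is_deriveB d2 (X 2 _ _ d1))).
  by rewrite !fctE /GRing.scale/=; ring.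
- apply: (is_derive_eq (is_deriveD (is_deriveB d3 (is_deriveZ 3 (is_deriveM d1
    d2)))
    (is_deriveZ 2 (X 3 _ _ d1)))).
  by rewrite !fctE /GRing.scale/=; ring.
- apply: (is_derive_eq (is_deriveB (is_deriveD (is_deriveB (is_deriveB d4
    (is_deriveZ 4 (is_deriveM d1 d3))) (is_deriveZ 3 (X 2 _ _ d2)))
    (is_deriveZ 12 (is_deriveM (X 2 _ _ d1) d2))) (is_deriveZ 6 (X 4 _ _ d1)))).
  by rewrite !fctE /GRing.scale/=; ring.
Qed.

(** Apart from its last term, the left-hand side is the complete Bell polynomial expressing the
    fifth moment through the cumulants, so it equals [r 5 t]. *)
Lemma cumulant_ode {R : realType} (r : nat -> R -> R) (a t : R) :
  r 5 t = 1 / 5 * t * r 1 t + 1 / 5 * a ->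
  cumulant r 4 t + 5 * cumulant r 0 t * cumulant r 3 t
    + 10 * (cumulant r 1 t + cumulant r 0 t ^+ 2) * cumulant r 2 t
    + 15 * cumulant r 0 t * (cumulant r 1 t) ^+ 2
    + 10 * (cumulant r 0 t) ^+ 3 * cumulant r 1 t
    + (cumulant r 0 t) ^+ 5 - 1 / 5 * t * cumulant r 0 t
  = 1 / 5 * a.
Proof.
rewrite /cumulant; move: (r 1) (r 2) (r 3) (r 4) (r 5) => r1 r2 r3 r4 r5.
by rewrite !fctE /GRing.scale/= => ->; ring.
Qed.

(** * Normalised moments and the derivatives of [beta1] *)

Section riccati.
Context {R : realType} (lambda : R).
Hypothesis l1 : -1 < lambda.

(** The k-th moment of the probability density proportional to s^lambda exp(-s^5 + ts) on the
    half-line; the parameter t is the exponential tilt. *)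
Let r k t : R := mu0 (lambda + k%:R) t / mu0 lambda t.

Let is_derive_r k (t : R) : is_derive t 1 (r k) (r k.+1 t - r k t * r 1 t).
Proof.
have lk : -1 < lambda + k%:R by rewrite ltr_wpDr.
have d0 := is_derive_mu0 lambda t l1; have dk := is_derive_mu0 _ t lk.
have m0 : mu0 lambda t != 0 by rewrite gt_eqF// mu0_gt0.
have dV := @is_deriveV _ _ _ _ _ m0 d0.
have dM := is_deriveM dk dV.
apply: (is_derive_eq dM).
rewrite /r -natr1 addrA /GRing.scale/=.
move: m0.
move: (mu0 lambda t) (mu0 (lambda + k%:R) t) (mu0 (lambda + k%:R + 1) t).
by move: (mu0 (lambda + 1) t) => a b c d b0; field.
Qed.

Let beta1_cumulant : beta1 lambda = cumulant r 0.
Proof. by apply/funext => t; rewrite beta1E. Qed.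

Let derive1n_beta1 n : (n <= 4)%N -> derive1n n (beta1 lambda) = cumulant r n.
Proof.
elim: n => [|n ih] n4; first by rewrite derive1n0 beta1_cumulant.
rewrite derive1nS ih ?(ltnW n4)//; apply/funext => t; rewrite derive1E.
by have [_ ->] := is_derive_cumulant _ is_derive_r n t n4.
Qed.

Lemma derivable_derive1n_beta1 n (t : R) : (n < 4)%N -> derivable (derive1n n
  (beta1 lambda)) t 1.
Proof.
by move=> n4; rewrite derive1n_beta1 ?(ltnW n4)//;
  have [] := is_derive_cumulant _ is_derive_r n t n4.
Qed.

Lemma is_derive_ln_mu0 (t : R) : is_derive t 1 (fun u : R => ln (mu0 lambda u))
  (beta1 lambda t).
Proof.
have d0 := is_derive_mu0 lambda t l1.
have dl := is_derive1_ln (mu0_gt0 lambda t l1).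
have dc := is_derive1_comp dl d0.
by apply: (is_derive_eq dc); rewrite beta1E// mulrC.
Qed.

Lemma beta1_ode (t : R) : let beta := beta1 lambda in
  derive1n 4 beta t + 5 * beta t * derive1n 3 beta t
    + 10 * (derive1 beta t + beta t ^+ 2) * derive1n 2 beta t
    + 15 * beta t * (derive1 beta t) ^+ 2
    + 10 * (beta t) ^+ 3 * derive1 beta t
    + (beta t) ^+ 5 - 1 / 5 * t * beta t
  = 1 / 5 * (lambda + 1).
Proof.
have E1 : derive1 (beta1 lambda) = cumulant r 1.
  by rewrite -(derive1n_beta1 1 isT) derive1n1.
move=> beta; rewrite /beta E1 (derive1n_beta1 2 isT) (derive1n_beta1 3 isT)
  (derive1n_beta1 4 isT).
rewrite beta1_cumulant; apply: cumulant_ode.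
have m0 : mu0 lambda t != 0 by rewrite gt_eqF// mu0_gt0.
(* Divided by [mu0 lambda t], the fifth-order equation becomes the required relation between [r 5]
   and [r 1]. *)
rewrite /r mu0D5//; move: m0.
by move: (mu0 lambda t) (mu0 (lambda + 1) t) => a b a0; field.
Qed.

End riccati.

Theorem lemma5p3 (R : realType) (lambda : R) (hlambda : -1 < lambda) :
  (forall t : R,
    [/\ (\int[lebesgue_measure]_x (decic_weight lambda t x)%:E
           = (mu0 lambda t)%:E)%E,
        (\int[lebesgue_measure]_(s in `]0%R, +oo[)
           (s `^ lambda * expR (- s ^+ 5 + t * s))%:E = (mu0 lambda t)%:E)%E
      & mu0 lambda t =
          1 / 5 * Gamma (lambda / 5 + 1 / 5)
            * hyp1F4 (lambda / 5 + 1 / 5)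
                (1 / 5) (2 / 5) (3 / 5) (4 / 5) ((t / 5) ^+ 5)
        + 1 / 5 * t * Gamma (lambda / 5 + 2 / 5)
            * hyp1F4 (lambda / 5 + 2 / 5)
                (2 / 5) (3 / 5) (4 / 5) (6 / 5) ((t / 5) ^+ 5)
        + 1 / 10 * t ^+ 2 * Gamma (lambda / 5 + 3 / 5)
            * hyp1F4 (lambda / 5 + 3 / 5)
                (3 / 5) (4 / 5) (6 / 5) (7 / 5) ((t / 5) ^+ 5)
        + 1 / 30 * t ^+ 3 * Gamma (lambda / 5 + 4 / 5)
            * hyp1F4 (lambda / 5 + 4 / 5)
                (4 / 5) (6 / 5) (7 / 5) (8 / 5) ((t / 5) ^+ 5)
        + 1 / 120 * t ^+ 4 * Gamma (lambda / 5 + 1)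
            * hyp1F4 (lambda / 5 + 1)
                (6 / 5) (7 / 5) (8 / 5) (9 / 5) ((t / 5) ^+ 5)]) /\
  (let phi := mu0 lambda in
    (forall (n : nat) (t : R), (n < 5)%N -> derivable (derive1n n phi) t 1) /\
    (forall t : R,
      derive1n 5 phi t - 1 / 5 * t * derive1 phi t - 1 / 5 * (lambda + 1) * phi t = 0)) /\
  (let beta := beta1 lambda in
    (forall t : R, is_derive t 1 (fun u : R => ln (mu0 lambda u)) (beta t)) /\
    (forall (n : nat) (t : R), (n < 4)%N -> derivable (derive1n n beta) t 1) /\
    (forall t : R,
      derive1n 4 beta t + 5 * beta t * derive1n 3 beta t
        + 10 * (derive1 beta t + beta t ^+ 2) * derive1n 2 beta t
        + 15 * beta t * (derive1 beta t) ^+ 2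
        + 10 * (beta t) ^+ 3 * derive1 beta t
        + (beta t) ^+ 5 - 1 / 5 * t * beta t
      = 1 / 5 * (lambda + 1))).
Proof.
split; [|split].
- move=> t; split; last exact: mu0_hyp1F4.
    by have [] := mu0E lambda t hlambda.
  have [h _] := mu0E lambda t hlambda.
  by rewrite -h integral_decic_weight.
- split.
    move=> n t n5; rewrite derive1n_mu0//.
    have ln : -1 < lambda + n%:R by rewrite ltr_wpDr.
    by have [] := is_derive_mu0 _ t ln.
  move=> t; rewrite derive1n_mu0// derive1_mu0// mu0D5//.
  by ring.
- split; last split.
  + exact: is_derive_ln_mu0.
  + by move=> n t; exact: derivable_derive1n_beta1.
  + exact: beta1_ode.
Qed.
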